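(* Let $G$ be a simple graph of order $n\ge 2$ with adjacency eigenvalues $\lambda_1\ge\lambda_2\ge\cdots\ge\lambda_n$, let $\boldsymbol{\lambda}=(\lambda_1,\dots,\lambda_n)$, and let $\boldsymbol{\mu}=(n-1,-1,\dots,-1)\in\mathbb{R}^n$. Then $$\frac{\lambda_1}{n-1}\,\boldsymbol{\mu}\;\prec\;\boldsymbol{\lambda}\;\prec\;|\lambda_n|\,\boldsymbol{\mu}.$$
   Context: The eigenvalues of a graph are those of its adjacency matrix. For $\boldsymbol{x},\boldsymbol{y}\in\mathbb{R}^n$, $\boldsymbol{x}\prec\boldsymbol{y}$ ($\boldsymbol{x}$ is majorized by $\boldsymbol{y}$) means $\sum_{j=1}^k x_j^{\downarrow}\le\sum_{j=1}^k y_j^{\downarrow}$ for $k=1,\dots,n$, with equality for $k=n$, where $\boldsymbol{x}^{\downarrow}$ is the decreasing rearrangement of $\boldsymbol{x}$. *)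

(* Defs.v *)
From HB Require Import structures.
From mathcomp Require Import all_boot all_order all_algebra.
From mathcomp Require Import reals.
Set Implicit Arguments.
Unset Strict Implicit.
Unset Printing Implicit Defensive.
Import Order.TTheory GRing.Theory Num.Theory.
Local Open Scope ring_scope.

Record simple_graph (V : finType) := SimpleGraph {
  adj :> rel V;
  adj_sym : symmetric adj;
  adj_irrefl : irreflexive adj }.

Definition adjacency_mx (R : realType) (V : finType) (G : simple_graph V) :
    'M[R]_#|V| :=
  \matrix_(i, j) (G (enum_val i) (enum_val j))%:R.

(* lam lists the eigenvalues of A in decreasing order, each repeated according
   to its multiplicity as a root of the characteristic polynomial.  The sizes
   m and n are kept separate to avoid casts; the equation forces m = n. *)
Definition eigenvalues_of (R : realType) (m n : nat) (A : 'M[R]_m)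
    (lam : n.-tuple R) : Prop :=
  sorted >=%R lam /\ char_poly A = \prod_(x <- lam) ('X - x%:P).

Definition decreasing_rearrangement (R : realType) (n : nat) (x : 'rV[R]_n) :
    seq R :=
  sort >=%R [seq x 0 i | i <- enum 'I_n].

Definition majorized_by (R : realType) (n : nat) (x y : 'rV[R]_n) : Prop :=
  (forall k : nat, (1 <= k <= n)%N ->
     \sum_(j < k) (decreasing_rearrangement x)`_j
       <= \sum_(j < k) (decreasing_rearrangement y)`_j) /\
  \sum_(j < n) (decreasing_rearrangement x)`_j
    = \sum_(j < n) (decreasing_rearrangement y)`_j.

Definition mu_vec (R : realType) (n : nat) : 'rV[R]_n :=
  \row_(i < n) (if i == 0%N :> nat then n%:R - 1 else -1).

(* Main.v *)
Require Import Defs.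
From HB Require Import structures.
From mathcomp Require Import all_boot all_order all_algebra.
From mathcomp Require Import reals.
From mathcomp Require Import lra.

(** A simple graph has no loops, so its adjacency matrix has zero trace and the
    eigenvalues sum to zero ([sum_eigenvalues_adjacency]).  Both
    majorizations then hold because they hold for every nonincreasing real
    sequence [lam] of length [n] with sum zero.

    Let [m = n - 1].  For [c >= 0] and [1 <= k <= n], the sum of the [k] largest
    entries of [c *: mu] is [c * (n - k)] ([psum_scaled_mu]), which vanishes
    at [k = n], as does the sum of [lam].  It remains to compare partial sums for [k < n].
    - Upper bound: the first [k] entries of [lam] sum to minus the last [n - k]
      ones, and each of these is at least the least entry, so the sum is at most
      [(n - k) * - lam_n].  Sum zero forces [lam_n <= 0], whence
      [- lam_n = `|lam_n|].
    - Lower bound: the entries after [lam_1] sum to [- lam_1]; since they are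
      nonincreasing, the average of the first [k - 1] of them is at least the
      average [- lam_1 / m] of all of them ([prefix_average_ge]).  Adding [lam_1]
      gives [lam_1 * (n - k) / m].  Sum zero also gives [lam_1 >= 0], as needed
      for the entries of [(lam_1 / m) *: mu] to be in decreasing order. *)

Set Implicit Arguments.
Unset Strict Implicit.
Unset Printing Implicit Defensive.
Import Order.TTheory GRing.Theory Num.Theory.
Local Open Scope ring_scope.

(** Both sides are minus the coefficient of degree [n - 1] of the characteristic
    polynomial. *)
Lemma sum_eigenvalues_trace (R : realType) (m n : nat) (A : 'M[R]_m)
    (lam : n.-tuple R) :
  (0 < n)%N -> eigenvalues_of A lam -> \sum_(x <- lam) x = \tr A.
Proof.
move=> n_gt0 [_ charE].
have mn : m = n.
  have := size_char_poly A; rewrite charE size_prod_XsubC size_tuple.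
  by case.
have m_gt0 : (0 < m)%N by rewrite mn.
apply: oppr_inj; rewrite -(char_poly_trace A m_gt0) charE mn.
rewrite -[in LHS](@coefPn_prod_XsubC _ lam) ?size_tuple //.
by rewrite -lt0n.
Qed.

Lemma sum_eigenvalues_adjacency (R : realType) (n : nat) (V : finType)
    (G : simple_graph V) (lam : n.-tuple R) :
  (0 < n)%N -> eigenvalues_of (adjacency_mx R G) lam -> \sum_(x <- lam) x = 0.
Proof.
move=> n_gt0 /(sum_eigenvalues_trace n_gt0) ->.
by rewrite /mxtrace big1 // => i _; rewrite mxE adj_irrefl.
Qed.

Lemma decreasing_rearrangement_sorted (R : realType) (n : nat)
    (s : n.-tuple R) :
  sorted >=%R s -> decreasing_rearrangement (\row_(i < n) tnth s i) = s.
Proof.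
move=> s_sorted; rewrite /decreasing_rearrangement.
rewrite (eq_map (g := tnth s)); last by move=> i; rewrite mxE.
by rewrite map_tnth_enum (sorted_sort ge_trans).
Qed.

Lemma decreasing_rearrangement_scaled_mu (R : realType) (m : nat) (c : R) :
  0 <= c ->
  decreasing_rearrangement (c *: mu_vec R m.+1)
    = c * m%:R :: nseq m (- c).
Proof.
move=> c_ge0; rewrite /decreasing_rearrangement.
have -> : [seq (c *: mu_vec R m.+1) 0 i | i <- enum 'I_m.+1]
          = c * m%:R :: nseq m (- c).
  rewrite enum_ordSl /= !mxE /= -natr1 addrK -map_comp; congr (_ :: _).
  rewrite -[in RHS](size_enum_ord m).
  by elim: (enum 'I_m) => //= i s ->; rewrite !mxE mulrN1.
apply: (sorted_sort ge_trans) => /=.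
case: m => //= m; rewrite (le_trans (y := 0)) ?oppr_le0 ?mulr_ge0 //=.
by elim: m => //= m ->; rewrite lexx.
Qed.

Lemma psum_scaled_mu (R : realType) (m k : nat) (c : R) :
  0 <= c -> (k <= m)%N ->
  \sum_(j < k.+1) (decreasing_rearrangement (c *: mu_vec R m.+1))`_j
    = c * (m - k)%:R.
Proof.
move=> c_ge0 le_km; rewrite decreasing_rearrangement_scaled_mu //.
rewrite big_ord_recl /= (eq_bigr (fun=> - c)) => [|j _].
  by rewrite sumr_const card_ord -[_ *+ k]mulr_natr mulNr -mulrBr natrB.
by rewrite /= nth_nseq (leq_trans (ltn_ord j)).
Qed.

(** With [f q] as pivot: the entries before [q] are at least [f q], and those
    from [q] on are at most [f q]. *)
Lemma prefix_average_ge (R : realType) (f : nat -> R) (p q : nat) :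
  (forall i j, (i <= j < p)%N -> f j <= f i) -> (q <= p)%N ->
  q%:R * \sum_(0 <= j < p) f j <= p%:R * \sum_(0 <= j < q) f j.
Proof.
move=> f_noninc; rewrite leq_eqVlt => /predU1P [-> // | lt_qp].
have le_qp := ltnW lt_qp.
have head_ge : q%:R * f q <= \sum_(0 <= j < q) f j.
  rewrite mulr_natl -[X in _ *+ X]subn0 -sumr_const_nat !big_nat.
  by apply: ler_sum => j /andP[_ lt_jq]; rewrite f_noninc // ltnW.
have tail_le : \sum_(q <= j < p) f j <= (p%:R - q%:R) * f q.
  rewrite -natrB // mulr_natl -sumr_const_nat !big_nat.
  by apply: ler_sum => j le_qjp; rewrite f_noninc.
rewrite (big_cat_nat _ (n := q)) //= mulrDr.
have q_ge0 : 0 <= q%:R :> R by [].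
have pq_ge0 : 0 <= p%:R - q%:R :> R by rewrite subr_ge0 ler_nat.
have := ler_wpM2l q_ge0 tail_le; have := ler_wpM2l pq_ge0 head_ge.
nra.
Qed.

Theorem lemma2p2 (R : realType) (n : nat) (V : finType) (G : simple_graph V)
    (lam : n.-tuple R) (hn : (2 <= n)%N) (hV : #|V| = n)
    (hlam : eigenvalues_of (adjacency_mx R G) lam) :
  majorized_by ((lam`_0 / (n%:R - 1)) *: mu_vec R n) (\row_(i < n) tnth lam i) /\
  majorized_by (\row_(i < n) tnth lam i) (`|lam`_n.-1| *: mu_vec R n).
Proof.
case: n lam hn hV hlam => [|m] // lam; rewrite ltnS => m_gt0 _ hlam.
have lam_sorted := hlam.1.
have sum0 : \sum_(0 <= j < m.+1) lam`_j = 0.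
  have := sum_eigenvalues_adjacency (ltn0Sn m) hlam.
  by rewrite (big_nth 0) size_tuple.
have noninc i j : (i <= j < m.+1)%N -> lam`_j <= lam`_i.
  case/andP=> le_ij lt_jm.
  apply: (sorted_leq_nth ge_trans lexx 0 lam_sorted) => //;
    by rewrite inE size_tuple // (leq_ltn_trans le_ij).
have mR_gt0 : 0 < m%:R :> R by rewrite ltr0n.
have lower k : (k <= m)%N ->
    lam`_0 * (m - k)%:R <= m%:R * \sum_(0 <= j < k.+1) lam`_j.
  move=> le_km.
  have := @prefix_average_ge R (fun j => lam`_j.+1) m k _ le_km.
  have -> : \sum_(0 <= j < m) lam`_j.+1 = - lam`_0.
    by apply/eqP; rewrite -addr_eq0 addrC -big_nat_recl // sum0.
  rewrite big_nat_recl // natrB // => avg.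
  have {}avg := avg (fun i j le_ijm => noninc i.+1 j.+1 le_ijm).
  lra.
have upper k : (k <= m)%N ->
    \sum_(0 <= j < k.+1) lam`_j <= - lam`_m * (m - k)%:R.
  move=> le_km; have := sum0; rewrite (big_cat_nat _ (n := k.+1)) //=.
  suff : (m - k)%:R * lam`_m <= \sum_(k.+1 <= j < m.+1) lam`_j by lra.
  rewrite mulr_natl -subSS -sumr_const_nat !big_nat.
  by apply: ler_sum => j /andP[_ lt_jm]; rewrite noninc // leqnn andbT -ltnS.
(* The first entry is at least the average of all entries, which is zero. *)
have first_ge0 : 0 <= lam`_0.
  have := prefix_average_ge noninc (isT : (1 <= m.+1)%N).
  by rewrite sum0 big_nat1 mulr0 pmulr_rge0 ?ltr0n.
(* At k = 0 the upper bound reads lam`_0 <= - lam`_m * m. *)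
have last_le0 : lam`_m <= 0.
  have := upper 0%N isT; rewrite big_nat1 subn0 => /(le_trans first_ge0).
  by rewrite pmulr_lge0 // oppr_ge0.
have c_ge0 : 0 <= lam`_0 / (m.+1%:R - 1).
  by rewrite -natr1 addrK divr_ge0.
rewrite /majorized_by decreasing_rearrangement_sorted //.
have sum0' : \sum_(j < m.+1) lam`_j = 0 by move: sum0; rewrite big_mkord.
split; split.
- case=> [|k] // le_km.
  rewrite psum_scaled_mu // -natr1 addrK mulrAC ler_pdivrMr //.
  by rewrite [leRHS]mulrC -(big_mkord xpredT (fun j => lam`_j)) lower.
- by rewrite psum_scaled_mu // subnn mulr0.
- case=> [|k] // le_km.
  rewrite psum_scaled_mu //= ler0_norm //.
  by rewrite -(big_mkord xpredT (fun j => lam`_j)) upper.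
- by rewrite psum_scaled_mu // subnn mulr0.
Qed.
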